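(* Let $(X,D)$ be an $\mathcal{F}$-metric space, and let $g: X\to X$ be a given mapping. Suppose that: (i) $(X,D)$ is $\mathcal{F}$-complete; (ii) there exists $k\in(0,1)$ such that $D(g(x),g(y))\le k\,D(x,y)$ for all $(x,y)\in X\times X$. Then $g$ has a unique fixed point $x^*\in X$. Moreover, for any $x_0\in X$, the sequence $\{x_n\}\subset X$ defined by $x_{n+1}=g(x_n)$, $n\in\mathbb{N}$, is $\mathcal{F}$-convergent to $x^*$.
   Context: $\mathbb{N}=\{0,1,2,\dots\}$. Let $\mathcal{F}$ be the set of functions $f:(0,+\infty)\to\mathbb{R}$ such that: $(\mathcal{F}_1)$ $f$ is non-decreasing, i.e. $0<s<t$ implies $f(s)\le f(t)$; $(\mathcal{F}_2)$ for every sequence $\{t_n\}\subset(0,+\infty)$, $\lim_{n\to+\infty}t_n=0$ if and only if $\lim_{n\to+\infty}f(t_n)=-\infty$. Let $X$ be a nonempty set and $D:X\times X\to[0,+\infty)$. $D$ is an $\mathcal{F}$-metric on $X$, and $(X,D)$ is an $\mathcal{F}$-metric space, if there exists $(f,\alpha)\in\mathcal{F}\times[0,+\infty)$ such that: (D1) for all $(x,y)\in X\times X$, $D(x,y)=0$ if and only if $x=y$; (D2) $D(x,y)=D(y,x)$ for all $(x,y)\in X\times X$; (D3) for every $(x,y)\in X\times X$, every $N\in\mathbb{N}$ with $N\ge2$, and every $(u_i)_{i=1}^N\subset X$ with $(u_1,u_N)=(x,y)$, if $D(x,y)>0$ then $f(D(x,y))\le f\left(\sum_{i=1}^{N-1}D(u_i,u_{i+1})\right)+\alpha$.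 For $x\in X$, $r>0$, put $B(x,r)=\{y\in X: D(x,y)<r\}$. A subset $\mathcal{O}\subset X$ is $\mathcal{F}$-open if for every $x\in\mathcal{O}$ there is $r>0$ with $B(x,r)\subset\mathcal{O}$. The $\mathcal{F}$-open sets form a topology $\tau_{\mathcal{F}}$ on $X$. A sequence $\{x_n\}\subset X$ is $\mathcal{F}$-convergent to $x\in X$ if it converges to $x$ with respect to $\tau_{\mathcal{F}}$, i.e. for every $\mathcal{F}$-open set $\mathcal{O}_x$ containing $x$ there is $N\in\mathbb{N}$ with $x_n\in\mathcal{O}_x$ for all $n\ge N$ (equivalently, $\lim_{n\to+\infty}D(x_n,x)=0$). A sequence $\{x_n\}\subset X$ is $\mathcal{F}$-Cauchy if $\lim_{n,m\to+\infty}D(x_n,x_m)=0$. $(X,D)$ is $\mathcal{F}$-complete if every $\mathcal{F}$-Cauchy sequence in $X$ is $\mathcal{F}$-convergent to some element of $X$. *)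

(* Defs.v *)
From Stdlib Require Import Reals.
From Coquelicot Require Import Coquelicot.
Open Scope R_scope.

(* A function on (0, +oo) is encoded as a total function on R of which only the
   values at positive arguments matter. *)
Record class_F (f : R -> R) : Prop := {
  F1 : forall s t : R, 0 < s -> s < t -> f s <= f t;
  F2 : forall t : nat -> R, (forall n, 0 < t n) ->
    (is_lim_seq t 0 <-> is_lim_seq (fun n => f (t n)) m_infty)
}.

Section FMetric.
Context {X : Type} (D : X -> X -> R).

(* In D3 the finite family (u_i), 1 <= i <= N, is the restriction of u : nat -> X
   to [1, N].  There f is only applied to positive reals: D x y > 0 and D1 force
   x <> y, hence some consecutive distance in the sum is positive. *)
Record F_metric_with (f : R -> R) (alpha : R) : Prop := {
  D1 : forall x y, D x y = 0 <-> x = y;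
  D2 : forall x y, D x y = D y x;
  D3 : forall (x y : X) (N : nat) (u : nat -> X),
    (2 <= N)%nat -> u 1%nat = x -> u N = y -> 0 < D x y ->
    f (D x y) <= f (sum_n_m (fun i => D (u i) (u (S i))) 1 (N - 1)) + alpha
}.

Definition F_metric : Prop :=
  (forall x y, 0 <= D x y) /\
  exists (f : R -> R) (alpha : R),
    class_F f /\ 0 <= alpha /\ F_metric_with f alpha.

Definition F_ball (x : X) (r : R) (y : X) : Prop := D x y < r.

Definition F_open (O : X -> Prop) : Prop :=
  forall x, O x -> exists r : R, 0 < r /\ forall y, F_ball x r y -> O y.

Definition F_convergent (u : nat -> X) (l : X) : Prop :=
  forall O : X -> Prop, F_open O -> O l ->
  exists N : nat, forall n : nat, (N <= n)%nat -> O (u n).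

Definition F_Cauchy (u : nat -> X) : Prop :=
  filterlim (fun p : nat * nat => D (u (fst p)) (u (snd p)))
    (filter_prod eventually eventually) (locally 0).

Definition F_complete : Prop :=
  forall u : nat -> X, F_Cauchy u -> exists l : X, F_convergent u l.

End FMetric.

(* Main.v *)
Require Import Defs.
From Stdlib Require Import Reals Lra Lia.
From Coquelicot Require Import Coquelicot.
Open Scope R_scope.

(** The chains of small total length starting at [x] reach an F-open set, and
    by (D3) together with (F2) their endpoints are D-close to [x].  Hence every
    ball is an F-neighbourhood of its centre, and F-convergence means
    convergence of D to 0.  The contraction makes the steps of an orbit decay
    geometrically, so the chains along its tails are short and the orbit is
    F-Cauchy; short chains through the orbit then show that its limit is
    fixed. *)

(** The last index is the total length. Growing a path at its end suits both the openness argument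
    and the orbit estimate better than the indexed families of [D3]. *)
Inductive chain {X : Type} (D : X -> X -> R) (x : X) : X -> R -> Prop :=
| chain_refl : chain D x x 0
| chain_snoc (y z : X) (s : R) : chain D x y s -> chain D x z (s + D y z).

Section FMetricTheory.
Context {X : Type} (D : X -> X -> R).

Lemma chain_family (x y : X) (s : R) : chain D x y s ->
  exists (N : nat) (u : nat -> X), (1 <= N)%nat /\ u 1%nat = x /\ u N = y /\
    sum_n_m (fun i => D (u i) (u (S i))) 1 (N - 1) = s.
Proof.
  induction 1 as [|y z s _ (N & u & HN & Hx & Hy & Hs)].
  (* With [N = 1] the sum runs from 1 to 0, so it is empty. *)
  - exists 1%nat, (fun _ => x).
    now repeat split.
  (* Among the indices up to [S N] only the last takes the [else] branch, so the old sum is kept. *)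
  - exists (S N), (fun i => if Nat.leb i N then u i else z).
    split; [lia|]. split.
    { destruct (Nat.leb_spec 1 N); [easy | lia]. }
    split.
    { destruct (Nat.leb_spec (S N) N); [lia | easy]. }
    destruct N as [|n]; [lia|].
    replace (S (S n) - 1)%nat with (S n) by lia.
    replace (S n - 1)%nat with n in Hs by lia.
    rewrite sum_n_Sm by lia.
    change plus with Rplus. f_equal.
    + rewrite <- Hs. apply sum_n_m_ext_loc. intros i Hi.
      destruct (Nat.leb_spec i (S n)); [|lia].
      destruct (Nat.leb_spec (S i) (S n)); [easy|lia].
    + destruct (Nat.leb_spec (S n) (S n)); [|lia].
      destruct (Nat.leb_spec (S (S n)) (S n)); [lia|].
      now rewrite Hy.
Qed.

(** [F2] along 1/(n+1) puts one value of [f] below [C]; by [F1] it bounds all values to its left. *)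
Lemma class_F_lt_near_0 (f : R -> R) (C : R) : class_F f ->
  exists delta : R, 0 < delta /\ forall s, 0 < s < delta -> f s < C.
Proof.
  intros [Hmono Hlim].
  assert (Hpos : forall n : nat, 0 < / (INR n + 1))
    by (intros n; apply Rinv_0_lt_compat; pose proof (pos_INR n); lra).
  assert (Hinv : is_lim_seq (fun n => / (INR n + 1)) 0).
  { apply (is_lim_seq_inv _ p_infty); [|easy].
    apply is_lim_seq_ext with (fun n => INR (S n)).
    - intros n. apply S_INR.
    - apply -> is_lim_seq_incr_1. apply is_lim_seq_INR. }
  apply (Hlim _ Hpos), is_lim_seq_spec in Hinv.
  destruct (Hinv C) as [N HN].
  exists (/ (INR N + 1)). split; [easy|]. intros s [Hs HsN].
  apply Rle_lt_trans with (2 := HN N (le_n N)). now apply Hmono.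
Qed.

Hypothesis D_metric : F_metric D.

Lemma F_metric_refl (x : X) : D x x = 0.
Proof. destruct D_metric as (_ & f & a & _ & _ & H). now apply (D1 _ _ _ H). Qed.

Lemma F_metric_sym (x y : X) : D x y = D y x.
Proof. destruct D_metric as (_ & f & a & _ & _ & H). apply (D2 _ _ _ H). Qed.

Lemma F_metric_eq_of_small (x y : X) :
  (forall eps, 0 < eps -> D x y < eps) -> x = y.
Proof.
  intros Hsmall. destruct D_metric as (Hnn & f & a & _ & _ & H).
  apply (D1 _ _ _ H). destruct (Hnn x y) as [Hp|]; [|easy].
  pose proof (Hsmall _ Hp). lra.
Qed.

(** Distinct endpoints thus give a positive length, where [class_F] controls [f]. *)
Lemma chain_nonneg (x y : X) (s : R) :
  chain D x y s -> 0 <= s /\ (s = 0 -> x = y).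
Proof.
  destruct D_metric as (Hnn & f & a & _ & _ & H).
  induction 1 as [|y z s _ [IHs IHe]]; [split; [lra | easy]|].
  pose proof (Hnn y z). split; [lra|]. intros Hs.
  rewrite IHe by lra. apply (D1 _ _ _ H). lra.
Qed.

(** This replaces the triangle inequality, uniformly in the number of steps. Were [D x y] at least
    [eps], [F1] and [D3] would give [f eps <= f s + a], against the choice of [delta]. *)
Lemma short_chain_close (eps : R) : 0 < eps ->
  exists delta : R, 0 < delta /\
    forall x y s, chain D x y s -> s < delta -> D x y < eps.
Proof.
  intros Heps. destruct D_metric as (Hnn & f & a & Hf & Ha & H).
  (* Lowering the threshold by [a] absorbs the additive constant of [D3]. *)
  destruct (class_F_lt_near_0 f (f eps - a) Hf) as (delta & Hdelta & Hlt).
  exists delta. split; [easy|]. intros x y s Hc Hs.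
  destruct (Rlt_or_le (D x y) eps) as [|Hge]; [easy|exfalso].
  assert (Hneq : x <> y).
  { intros ->. rewrite F_metric_refl in Hge. lra. }
  destruct (chain_nonneg _ _ _ Hc) as [Hs0 Hs0eq].
  assert (Hspos : 0 < s).
  { destruct Hs0 as [|Hs0]; [easy|]. now destruct Hneq; apply Hs0eq. }
  destruct (chain_family _ _ _ Hc) as (N & u & HN & Hx & Hy & Hsum).
  assert (HN2 : (2 <= N)%nat).
  { destruct (Nat.eq_dec N 1) as [->|]; [|lia]. destruct Hneq. congruence. }
  pose proof (D3 _ _ _ H x y N u HN2 Hx Hy ltac:(lra)) as H3.
  rewrite Hsum in H3. pose proof (Hlt s (conj Hspos Hs)).
  assert (f eps <= f (D x y)); [|lra].
  destruct Hge as [Hgt| ->]; [|lra]. now apply (F1 _ Hf).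
Qed.

(** A chain of length [s] can be prolonged by any step shorter than the slack [delta - s]. *)
Lemma F_open_short_chains (x : X) (delta : R) :
  F_open D (fun y => exists s, chain D x y s /\ s < delta).
Proof.
  intros y (s & Hc & Hs). exists (delta - s). split; [lra|].
  unfold F_ball. intros z Hz. exists (s + D y z).
  split; [now apply chain_snoc | lra].
Qed.

(** From left to right, convergence is tested on the open set of endpoints of short chains from [l],
    which lies in a small ball. *)
Lemma F_convergent_iff (u : nat -> X) (l : X) :
  F_convergent D u l <-> is_lim_seq (fun n => D (u n) l) 0.
Proof.
  rewrite <- is_lim_seq_spec. split.
  - intros Hu eps.
    destruct (short_chain_close eps (cond_pos eps)) as (delta & Hdelta & Hclose).
    destruct (Hu _ (F_open_short_chains l delta)) as [N HN].
    { exists 0. split; [constructor | easy]. }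
    exists N. intros n Hn. destruct (HN n Hn) as (s & Hc & Hs).
    pose proof (Hclose _ _ _ Hc Hs). pose proof (proj1 D_metric (u n) l).
    rewrite (F_metric_sym l) in *. rewrite Rminus_0_r, Rabs_pos_eq; easy.
  - intros Hu O HO Hl. destruct (HO l Hl) as (r & Hr & Hball).
    destruct (Hu (mkposreal r Hr)) as [N HN]. simpl in HN.
    exists N. intros n Hn. apply Hball. unfold F_ball.
    specialize (HN n Hn). rewrite Rminus_0_r in HN.
    rewrite F_metric_sym. pose proof (Rle_abs (D (u n) l)). lra.
Qed.

(** By symmetry of [D], ordered pairs of indices suffice. *)
Lemma F_CauchyI (u : nat -> X) :
  (forall eps, 0 < eps -> exists N : nat, forall n m : nat,
     (N <= n)%nat -> (n <= m)%nat -> D (u n) (u m) < eps) ->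
  F_Cauchy D u.
Proof.
  intros Hu. apply filterlim_locally. intros eps.
  destruct (Hu eps (cond_pos eps)) as [N HN].
  apply Filter_prod with (fun n => N <= n)%nat (fun n => N <= n)%nat;
    [now exists N | now exists N |].
  intros n m Hn Hm. change (Rabs (D (u n) (u m) - 0) < eps).
  rewrite Rminus_0_r, Rabs_pos_eq by apply D_metric.
  destruct (Nat.le_ge_cases n m).
  - now apply HN.
  - rewrite F_metric_sym. now apply HN.
Qed.

Variables (g : X -> X) (k : R).
Hypothesis k_bounds : 0 < k < 1.
Hypothesis g_contr : forall x y : X, D (g x) (g y) <= k * D x y.

Lemma is_lim_seq_geom_scal (c : R) : is_lim_seq (fun n => c * k ^ n) 0.
Proof.
  replace (Finite 0) with (Rbar_mult c 0) by (simpl; f_equal; ring).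
  apply is_lim_seq_scal_l, is_lim_seq_geom. rewrite Rabs_pos_eq; lra.
Qed.

Section Orbit.
Variable x : nat -> X.
Hypothesis x_orbit : forall n : nat, x (S n) = g (x n).

Lemma orbit_step (n : nat) : D (x n) (x (S n)) <= D (x 0%nat) (x 1%nat) * k ^ n.
Proof.
  induction n as [|n IH]; [simpl; lra|].
  rewrite (x_orbit (S n)), (x_orbit n) at 1.
  eapply Rle_trans; [apply g_contr|].
  simpl. nra.
Qed.

(** The geometric sum of the step bounds telescopes, as (1 - k) k^i = k^i - k^(i+1); the factor
    [1 - k] on the left avoids a division. *)
Lemma orbit_chain (n p : nat) : exists s, chain D (x n) (x (n + p)%nat) s /\
  (1 - k) * s <= D (x 0%nat) (x 1%nat) * (k ^ n - k ^ (n + p)).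
Proof.
  induction p as [|p (s & Hc & Hs)].
  - exists 0. rewrite Nat.add_0_r. split; [constructor | lra].
  - exists (s + D (x (n + p)%nat) (x (S (n + p)))).
    rewrite Nat.add_succ_r. split; [now apply chain_snoc|].
    pose proof (orbit_step (n + p)). simpl. nra.
Qed.

Lemma orbit_Cauchy : F_Cauchy D x.
Proof.
  apply F_CauchyI. intros eps Heps.
  destruct (short_chain_close eps Heps) as (delta & Hdelta & Hclose).
  set (d := D (x 0%nat) (x 1%nat)).
  assert (Hd : 0 <= d) by apply D_metric.
  (* This tolerance matches the left side of [orbit_chain]: once [d * k ^ n] is below it, the chain
     is shorter than [delta]. *)
  assert (Hpos : 0 < (1 - k) * delta) by (apply Rmult_lt_0_compat; lra).
  pose proof (is_lim_seq_geom_scal d) as Hg. apply is_lim_seq_spec in Hg.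
  destruct (Hg (mkposreal _ Hpos)) as [N HN]. simpl in HN.
  exists N. intros n m Hn Hm.
  destruct (orbit_chain n (m - n)) as (s & Hc & Hs). fold d in Hs.
  replace (n + (m - n))%nat with m in * by lia.
  apply (Hclose _ _ _ Hc).
  specialize (HN n Hn). rewrite Rminus_0_r in HN.
  pose proof (Rle_abs (d * k ^ n)).
  assert (0 <= k ^ m) by (apply pow_le; lra).
  apply Rmult_lt_reg_l with (1 - k); [lra|]. nra.
Qed.

(** The chain [l], [x (S N)], [g l] is arbitrarily short, its second step being at most
    [k * D (x N) l] by contraction. *)
Lemma orbit_limit_fixed (l : X) : F_convergent D x l -> g l = l.
Proof.
  intros Hl. apply F_convergent_iff, is_lim_seq_spec in Hl.
  symmetry. apply F_metric_eq_of_small. intros eps Heps.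
  destruct (short_chain_close eps Heps) as (delta & Hdelta & Hclose).
  (* Half of [delta] goes to each of the two steps of the chain. *)
  destruct (Hl (mkposreal _ (is_pos_div_2 (mkposreal _ Hdelta)))) as [N HN].
  simpl in HN.
  apply (Hclose l (g l) (0 + D l (x (S N)) + D (x (S N)) (g l))).
  { apply chain_snoc, chain_snoc, chain_refl. }
  pose proof (HN N ltac:(lia)) as H0. pose proof (HN (S N) ltac:(lia)) as H1.
  rewrite Rminus_0_r in H0, H1.
  pose proof (Rle_abs (D (x N) l)). pose proof (Rle_abs (D (x (S N)) l)).
  rewrite (F_metric_sym l). rewrite (x_orbit N) at 2.
  pose proof (g_contr (x N) l). pose proof (proj1 D_metric (x N) l). nra.
Qed.

(** Each application of [g] shrinks the distance to the fixed point by the factor [k], wherever the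
    orbit starts. *)
Lemma orbit_convergent (l : X) : g l = l -> F_convergent D x l.
Proof.
  intros Hl. apply F_convergent_iff.
  apply is_lim_seq_le_le with (fun _ => 0) (fun n => D (x 0%nat) l * k ^ n).
  - intros n. split; [apply D_metric|].
    induction n as [|n IH]; [simpl; lra|].
    rewrite x_orbit, <- Hl at 1.
    eapply Rle_trans; [apply g_contr|]. simpl. nra.
  - apply is_lim_seq_const.
  - apply is_lim_seq_geom_scal.
Qed.

End Orbit.

Lemma contraction_fixed_unique (x y : X) : g x = x -> g y = y -> x = y.
Proof.
  intros Hx Hy. apply F_metric_eq_of_small. intros eps Heps.
  pose proof (g_contr x y) as H. rewrite Hx, Hy in H.
  pose proof (proj1 D_metric x y). nra.
Qed.

End FMetricTheory.

Theorem theorem5p1 (X : Type) (D : X -> X -> R) (g : X -> X)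
  (X_nonempty : inhabited X)
  (D_metric : F_metric D)
  (D_complete : F_complete D)
  (g_contraction : exists k : R, 0 < k < 1 /\
     forall x y : X, D (g x) (g y) <= k * D x y) :
  exists xstar : X,
    unique (fun x => g x = x) xstar /\
    forall (x0 : X) (x : nat -> X),
      x 0%nat = x0 -> (forall n : nat, x (S n) = g (x n)) ->
      F_convergent D x xstar.
Proof.
  destruct X_nonempty as [a], g_contraction as (k & Hk & Hg).
  assert (Horb : forall n, Nat.iter (S n) g a = g (Nat.iter n g a)) by easy.
  (* The orbit of one arbitrary point yields the fixed point; every other orbit is then compared
     with it directly. *)
  destruct (D_complete (fun n => Nat.iter n g a)) as [l Hl].
  { now apply orbit_Cauchy with g k. }
  assert (Hfix : g l = l)
    by now apply orbit_limit_fixed with D k (fun n => Nat.iter n g a).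
  exists l. split; [split; [easy|]|].
  - intros y Hy. now apply contraction_fixed_unique with D g k.
  - intros x0 x _ Hx. now apply orbit_convergent with g k.
Qed.
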